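(* Let $(T,q,0,w)$ be basic data (with trace $0$) such that $c_1\ge 1$, $c_2\ge 1$ and the rule $w$ has three invertible corners, that is, $w(0)$, $w(c_1e_1)$ and $w(c_2e_2)$ are all invertible in $\mathbb Z/q\mathbb Z$. Then the associated $2$-graph $\Lambda=\Lambda(T,q,0,w)$ is aperiodic: for every $v\in\Lambda^0$ and all $m,n\in\mathbb N^2$ with $m\ne n$ there is a path $\lambda$ in $\Lambda$ with $r(\lambda)=v$, $d(\lambda)\ge m\vee n$ and $$\lambda(m,m+d(\lambda)-(m\vee n))\neq\lambda(n,n+d(\lambda)-(m\vee n)).$$
   Context: $\mathbb N=\{0,1,2,\dots\}$; $e_1,e_2$ is the usual basis of $\mathbb Z^2$; $m\le n$ in $\mathbb Z^2$ is meant coordinatewise and $m\vee n$ is the coordinatewise maximum. A tile is a finite subset $T\subset\mathbb N^2$ containing $0$ which is hereditary ($j\in T$ and $0\le i\le j$ imply $i\in T$). Basic data $(T,q,t,w)$ consist of a tile $T$, an integer $q\ge 2$, an element $t\in\mathbb Z/q\mathbb Z$ (the trace) and a function $w:T\to\mathbb Z/q\mathbb Z$ (the rule). Let $(c_1,c_2)$ be the coordinatewise maximum of the elements of $T$. The vertex set is $\Lambda^0=\{v:T\to\mathbb Z/q\mathbb Z:\sum_{i\in T}w(i)v(i)=t\}$. For $n\in\mathbb N^2$ put $T(n)=\bigcup_{0\le m\le n}(T+m)$. If $f$ is a $\mathbb Z/q\mathbb Z$-valued function whose domain contains $T+n$, define $f|_{T+n}:T\to\mathbb Z/q\mathbb Z$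 by $f|_{T+n}(i)=f(i+n)$. A path of degree $n$ is a function $\lambda:T(n)\to\mathbb Z/q\mathbb Z$ such that $\lambda|_{T+m}\in\Lambda^0$ for all $0\le m\le n$; $\Lambda^n$ is the set of these, and $d(\lambda)=n$ for $\lambda\in\Lambda^n$. The source and range of $\lambda\in\Lambda^n$ are $s(\lambda)=\lambda|_{T+n}$ and $r(\lambda)=\lambda|_T$. For $\lambda\in\Lambda^p$ and $0\le m\le n\le p$, the segment $\lambda(m,n)\in\Lambda^{n-m}$ is $\lambda(m,n)(i)=\lambda(m+i)$ for $i\in T(n-m)$. If $w(c_1e_1)$ and $w(c_2e_2)$ are invertible, then for $\mu\in\Lambda^m$, $\nu\in\Lambda^n$ with $s(\mu)=r(\nu)$ there is a unique $\mu\nu\in\Lambda^{m+n}$ with $(\mu\nu)(0,m)=\mu$ and $(\mu\nu)(m,m+n)=\nu$; with this composition, objects $\Lambda^0$, morphisms $\bigcup_n\Lambda^n$ and degree map $d$, one obtains a $2$-graph $\Lambda(T,q,t,w)$. *)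

(* Defs.v *)
From mathcomp Require Import all_boot all_order all_algebra finmap.

Set Implicit Arguments.
Unset Strict Implicit.
Unset Printing Implicit Defensive.

Import Order.TTheory GRing.Theory.
(* N^2 is [nat * nat] with the library's pointwise [+%R], and, thanks to this
   import, with the coordinatewise order [(_ <= _)%O] and join [Order.join]. *)
Export Order.DefaultProdOrder.

Local Open Scope fset_scope.
Local Open Scope fmap_scope.
Local Open Scope ring_scope.

(* Truncated; only used for [m <= n]. *)
Definition sub2 (n m : nat * nat) : nat * nat := (n.1 - m.1, n.2 - m.2)%N.

Definition is_tile (T : {fset nat * nat}) : Prop :=
  (0 : nat * nat) \in T /\
  forall i j : nat * nat, j \in T -> (i <= j)%O -> i \in T.

Definition c1 (T : {fset nat * nat}) : nat := (\max_(i <- T) i.1)%N.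
Definition c2 (T : {fset nat * nat}) : nat := (\max_(i <- T) i.2)%N.

Definition box (n : nat * nat) : seq (nat * nat) :=
  [seq (a, b) | a <- iota 0 n.1.+1, b <- iota 0 n.2.+1].

Definition translate (T : {fset nat * nat}) (m : nat * nat) :
    {fset nat * nat} := [fset (i + m : nat * nat) | i in T].

Definition tile_at (T : {fset nat * nat}) (n : nat * nat) : {fset nat * nat} :=
  \bigcup_(m <- box n) translate T m.

(* A function to Z/q whose domain is a finite subset D of N^2 is a finite map
   of domain [domf f = D], so that equality includes equality of the domains. *)
Definition pfun (q : nat) := {fmap (nat * nat)%type -> 'Z_q}.

(* The value 0 outside the domain is junk; it is never used, see [corners] and
   [segment_is_path] below. *)
Definition ev (q : nat) (f : pfun q) (i : nat * nat) : 'Z_q :=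
  odflt 0 f.[? i].

(* The function i |-> f (i + m) on D, for f defined on D + m. *)
Definition shift (q : nat) (f : pfun q) (D : {fset nat * nat})
    (m : nat * nat) : pfun q := [fmap i : D => ev f (val i + m)].

(* 'Z_q is Z/q only for q >= 2, which is part of the basic data. *)
Definition basic_data (T : {fset nat * nat}) (q : nat) (t : 'Z_q)
    (w : pfun q) : Prop := [/\ is_tile T, (2 <= q)%N & domf w = T].

Section TwoGraph.
Variables (T : {fset nat * nat}) (q : nat) (t : 'Z_q) (w : pfun q).

Definition is_vertex (v : pfun q) : Prop :=
  domf v = T /\ \sum_(i <- T) ev w i * ev v i = t.

Definition restr (f : pfun q) (m : nat * nat) : pfun q := shift f T m.

Definition is_path (n : nat * nat) (l : pfun q) : Prop :=
  domf l = tile_at T n /\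
  forall m : nat * nat, (m <= n)%O -> is_vertex (restr l m).

Definition range (l : pfun q) : pfun q := restr l 0.
Definition source (n : nat * nat) (l : pfun q) : pfun q := restr l n.

Definition segment (l : pfun q) (m n : nat * nat) : pfun q :=
  shift l (tile_at T (sub2 n m)) m.

Definition aperiodic : Prop :=
  forall v : pfun q, is_vertex v ->
  forall m n : nat * nat, m <> n ->
  exists (d : nat * nat) (l : pfun q),
    [/\ is_path d l, range l = v, (Order.join m n <= d)%O &
        segment l m (sub2 (m + d) (Order.join m n)) <>
        segment l n (sub2 (n + d) (Order.join m n))].

End TwoGraph.

Lemma mem_box (m n : nat * nat) : (m \in box n) = (m <= n)%O.
Proof.
have mem0 (k x : nat) : (x \in iota 0 k.+1) = (x <= k)%N.
  by rewrite mem_iota add0n ltnS.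
apply/allpairsP/andP => [[[a b]] | [Ha Hb]].
  by case=> Ha Hb ->; rewrite !mem0 in Ha Hb.
by exists m; rewrite !mem0; split=> //; case: m {Ha Hb}.
Qed.

Lemma mem_translate (T : {fset nat * nat}) (m i : nat * nat) :
  reflect (exists2 j, j \in T & i = j + m) (i \in translate T m).
Proof. by apply: (iffP (imfsetP _ _ _ _)) => -[j Tj ->]; exists j. Qed.

Lemma mem_tile_at (T : {fset nat * nat}) (n i : nat * nat) :
  reflect (exists2 m : nat * nat, (m <= n)%O & i \in translate T m)
          (i \in tile_at T n).
Proof.
apply: (iffP (bigfcupP _ _ _ _)) => [[m] | [m le_mn Hi]].
  by rewrite mem_box andbT => le_mn Hi; exists m.
by exists m => //; rewrite mem_box andbT.
Qed.

Lemma tile_at0 (T : {fset nat * nat}) : tile_at T 0 = T.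
Proof.
apply/fsetP => i; apply/mem_tile_at/idP => [[[a b]] | Ti].
  case/andP=> Ha Hb; have [-> ->] : a = 0%N /\ b = 0%N.
    by move: a b Ha Hb => [|a] [|b].
  by case/mem_translate => j Tj ->; rewrite addr0.
by exists 0 => //; apply/mem_translate; exists i; rewrite ?addr0.
Qed.

Lemma corners (T : {fset nat * nat}) :
  is_tile T -> (c1 T, 0%N) \in T /\ (0%N, c2 T) \in T.
Proof.
case=> T0 hT.
have max_in (f : nat * nat -> nat) :
    f 0 = 0%N -> exists2 j, j \in T & (\max_(i <- T) f i)%N = f j.
  move=> f0; rewrite big_seq.
  apply: (big_ind (fun k => exists2 j, j \in T & k = f j)).
  - by exists 0.
  - by move=> x y [a Ta ->] [b Tb ->]; rewrite /maxn; case: ifP; [exists b | exists a].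
  - by move=> i Ti; exists i.
split.
  have [[a b] Tj Ej] := max_in fst erefl.
  by rewrite /c1 Ej; apply: hT Tj _; apply/andP; split=> /=.
have [[a b] Tj Ej] := max_in snd erefl.
by rewrite /c2 Ej; apply: hT Tj _; apply/andP; split=> /=.
Qed.

Lemma evE (q : nat) (f : pfun q) (i : nat * nat) (hi : i \in domf f) :
  ev f i = f [` hi].
Proof. by rewrite /ev in_fnd. Qed.

Lemma ev_shift (q : nat) (f : pfun q) (D : {fset nat * nat})
    (m i : nat * nat) : i \in D -> ev (shift f D m) i = ev f (i + m).
Proof. by move=> hi; rewrite evE /shift ffunE. Qed.

Lemma segment_is_path (T : {fset nat * nat}) (q : nat) (t : 'Z_q)
    (w l : pfun q) (m n p : nat * nat) :
  (m <= n)%O -> (n <= p)%O -> is_path T t w p l ->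
  is_path T t w (sub2 n m) (segment T l m n) /\
  forall i, i \in tile_at T (sub2 n m) ->
    i + m \in domf l /\ ev (segment T l m n) i = ev l (i + m).
Proof.
move=> /andP[mn1 mn2] /andP[np1 np2] [dom_l vl].
have le_add (k : nat * nat) : (k <= sub2 n m)%O -> (k + m <= p)%O.
  case/andP=> /= k1 k2; apply/andP; split => /=.
    by apply: leq_trans np1; rewrite -(subnK mn1) leq_add2r.
  by apply: leq_trans np2; rewrite -(subnK mn2) leq_add2r.
have in_tile (k i : nat * nat) :
    (k <= sub2 n m)%O -> i \in T -> i + k \in tile_at T (sub2 n m).
  by move=> le_k Ti; apply/mem_tile_at; exists k => //; apply/mem_translate; exists i.
split; last first.
  move=> i hi; split; last exact: ev_shift.
  rewrite dom_l; case/mem_tile_at: hi => k le_k /mem_translate[j Tj ->].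
  apply/mem_tile_at; exists (k + m); first exact: le_add.
  by apply/mem_translate; exists j; [exact: Tj | rewrite addrA].
split; first by [].
move=> k le_k; have [_ sum_t] := vl _ (le_add _ le_k).
split; first by [].
rewrite -sum_t big_seq [RHS]big_seq; apply: eq_bigr => i Ti.
congr (_ * _); rewrite /restr (ev_shift _ _ Ti) (ev_shift _ _ Ti).
rewrite /segment (ev_shift _ _ (in_tile _ _ le_k Ti)).
by congr ev; rewrite addrA.
Qed.

(* Main.v *)
(* Write P for the polynomial [\sum_(j in T) w j x^j] over Z/q and identify a
   path with a function g on N^2 annihilated by P on the translates T + i with
   i <= d.  Suppose that m and n contradict the theorem for some v.  By
   linearity, g (k + m) - g (k + n) then depends only on k and on the range of
   g, which takes finitely many values, so by the pigeonhole principle two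
   indices k <> k' of a long arithmetic progression of direction m - n give the
   same function of g.  Hence Q = (x^k - x^k') (x^m - x^n) annihilates every
   path of degree d.  As w 0 is invertible, P has an inverse power series, and
   for z outside the box [0, d] the function i |-> [x^(z - i)] P^-1 is a path;
   therefore A = Q / P is a polynomial.  Now Q = P A is nonzero with support on
   one line of direction m - n, which is impossible: comparing the points where
   suitable linear forms are extremal on the support of A, the three invertible
   corners of P put points of P A on at least two parallel lines. *)
Require Import Defs.
From mathcomp Require Import all_boot all_order all_algebra finmap.
From mathcomp Require Import boolp zify ring.
Set Implicit Arguments.
Unset Strict Implicit.
Unset Printing Implicit Defensive.
Import Order.TTheory GRing.Theory Num.Theory.
Local Open Scope fset_scope.
Local Open Scope ring_scope.

Lemma le_pairE (m n : nat * nat) :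
  (m <= n)%O = (m.1 <= n.1)%N && (m.2 <= n.2)%N.
Proof. by []. Qed.

(** * Extension of paths *)

Section Residue.
Variables (T : {fset nat * nat}) (R : comUnitRingType) (w : nat * nat -> R).
Implicit Types (f g : nat * nat -> R) (i j c m n d : nat * nat).

Definition residue f m : R := \sum_(j <- T) w j * f (j + m).

Lemma eq_residue f g m :
  (forall j, j \in T -> f (j + m) = g (j + m)) -> residue f m = residue g m.
Proof.
move=> efg; rewrite /residue big_seq [RHS]big_seq.
by apply: eq_bigr => j Tj; rewrite efg.
Qed.

Lemma residueD f g m :
  residue (fun i => f i + g i) m = residue f m + residue g m.
Proof.
by rewrite /residue -big_split; apply: eq_bigr => j _; rewrite mulrDr.
Qed.

Lemma residueB f g m :
  residue (fun i => f i - g i) m = residue f m - residue g m.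
Proof. by rewrite /residue -sumrB; apply: eq_bigr => j _; rewrite mulrBr. Qed.

(** Only the term [j = c] of the residue at [m] sees the value at [c + m], and it does so with the
    invertible factor [w c]; correcting that one value suffices. *)
Lemma residue_solve f c m : c \in T -> w c \is a GRing.unit ->
  exists g, residue g m = 0 /\ forall i, i <> c + m -> g i = f i.
Proof.
move=> Tc wc.
exists (fun i => f i - (if i == c + m then (w c)^-1 * residue f m else 0)).
split; last by move=> i /eqP /negPf ->; rewrite subr0.
rewrite residueB [X in _ - X](bigD1_seq c) ?fset_uniq //= eqxx mulVKr //.
rewrite big1 ?addr0 ?subrr // => j njc.
have -> : (j + m == c + m) = false.
  apply/negP => /eqP[e1 e2]; case/negP: njc; apply/eqP.
  case: j c m e1 e2 {Tc wc} => [j1 j2] [a1 a2] [m1 m2] /=.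
  by move=> /addIn -> /addIn ->.
by rewrite mulr0.
Qed.

Hypothesis tileT : is_tile T.
Hypothesis w1 : w (c1 T, 0%N) \is a GRing.unit.
Hypothesis w2 : w (0%N, c2 T) \is a GRing.unit.

Lemma le_c1 j : j \in T -> (j.1 <= c1 T)%N.
Proof.
move=> Tj; rewrite /c1.
by rewrite (@leq_bigmax_seq _ (T : seq _) predT (fun i : nat * nat => i.1) j).
Qed.

Lemma le_c2 j : j \in T -> (j.2 <= c2 T)%N.
Proof.
move=> Tj; rewrite /c2.
by rewrite (@leq_bigmax_seq _ (T : seq _) predT (fun i : nat * nat => i.2) j).
Qed.

(* The corner c1 e1 lets the bottom row be filled from left to right; each later
   row is then filled from right to left with the corner c2 e2, which leaves the
   constraints already met untouched. *)
Lemma extend_row0 f x : residue f 0 = 0 ->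
  exists g, (forall j, j \in T -> g j = f j) /\
            forall y, (y <= x)%N -> residue g (y, 0%N) = 0.
Proof.
move=> f0; elim: x => [|x [g [gf gx]]].
  by exists f; split=> // y; rewrite leqn0 => /eqP ->.
have [h [hx hg]] := residue_solve g (x.+1, 0%N) (proj1 (corners tileT)) w1.
exists h; split.
  move=> j Tj; rewrite hg ?gf // => e; move: (le_c1 Tj).
  by rewrite e /=; lia.
move=> y; rewrite leq_eqVlt => /predU1P[-> // | lt_yx].
rewrite -(gx y) //; apply: eq_residue => j Tj; apply: hg.
by case=> /= e _; move: (le_c1 Tj) e; lia.
Qed.

Lemma extend_box f d : residue f 0 = 0 ->
  exists g, (forall j, j \in T -> g j = f j) /\
            forall m, (m <= d)%O -> residue g m = 0.
Proof.
case: d => a b f0.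
suff: exists g, (forall j, j \in T -> g j = f j) /\
      forall x y, (x <= a)%N -> (y <= b)%N -> residue g (x, y) = 0.
  by case=> g [gf gab]; exists g; split=> // -[x y] /andP[]; apply: gab.
elim: b => [|b [g [gf gb]]].
  have [g [gf gx]] := extend_row0 a f0.
  by exists g; split=> // x y xa; rewrite leqn0 => /eqP ->; apply: gx.
(* Here [k] counts the constraints of row [b.+1] treated so far, from the right. The next one is met
   by changing the value at [(a - k, b.+1 + c2 T)]: this point lies above all rows used by earlier
   rows of constraints, and to the left of every translate of [T] treated in this row. *)
suff: forall k, exists h, (forall i, (i.2 <= b + c2 T)%N -> h i = g i) /\
        forall x, (a < x + k)%N -> (x <= a)%N -> residue h (x, b.+1) = 0.
  case/(_ a.+1) => h [hg hb]; exists h; split.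
    by move=> j Tj; rewrite hg ?gf //; move: (le_c2 Tj); lia.
  move=> x y xa; rewrite leq_eqVlt => /predU1P[-> | lt_yb].
    by apply: hb => //; lia.
  rewrite -(gb x y) //; apply: eq_residue => j Tj; apply: hg.
  move: (le_c2 Tj); rewrite /=; lia.
elim=> [|k [h [hg hk]]].
  by exists g; split=> // x; lia.
have [le_ka | lt_ak] := leqP k a; last first.
  by exists h; split=> // x ? ?; apply: hk; lia.
have [h' [h'k h'h]] :=
  residue_solve h ((a - k)%N, b.+1) (proj2 (corners tileT)) w2.
exists h'; split.
  move=> i ib; rewrite h'h ?hg // => e; move: ib.
  rewrite e /=; lia.
move=> x xk xa; have [-> // | ne_x] := eqVneq x (a - k)%N.
rewrite -(hk x) //; last by lia.
apply: eq_residue => j Tj; apply: h'h; case=> /= + _.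
lia.
Qed.

End Residue.

(** * The inverse power series *)

Definition emb (i : nat * nat) : int * int := (i.1%:Z, i.2%:Z).

Lemma embD i j : emb (i + j) = emb i + emb j.
Proof. by []. Qed.

Lemma emb_inj : injective emb.
Proof. by move=> [a b] [c d] [-> ->]. Qed.

Section Inverse.
Variables (T : {fset nat * nat}) (R : comUnitRingType) (w : nat * nat -> R).
Implicit Types (i j : nat * nat) (z : int * int).
Hypothesis T0 : (0 : nat * nat) \in T.
Hypothesis w0 : w 0 \is a GRing.unit.

Definition delta z : R := (z == 0)%:R.

(* [n] is the fuel of the recursion; the result is the coefficient at [z] of
   the inverse of [\sum_(j in T) w j x^j] as soon as [z.1 + z.2 < n]. *)
Fixpoint inverse_rec (n : nat) z : R :=
  if n is n'.+1 then
    if (0 <= z.1) && (0 <= z.2) then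
      (w 0)^-1 * (delta z -
        \sum_(j <- T | j != 0) w j * inverse_rec n' (z - emb j))
    else 0
  else 0.

Definition inverse z : R := inverse_rec (absz (z.1 + z.2)).+1 z.

Lemma inverse_rec_out n z :
  ~~ ((0 <= z.1) && (0 <= z.2)) -> inverse_rec n z = 0.
Proof. by case: n => //= n /negPf ->. Qed.

(** Each recursive call lowers the coordinate sum by at least 1, and once the sum is negative [z]
    lies outside the quadrant. *)
Lemma inverse_rec_stable n z : z.1 + z.2 < n%:Z ->
  inverse_rec n z = inverse_rec n.+1 z.
Proof.
elim: n z => [|n IH] z zn.
  by rewrite !inverse_rec_out //; apply/negP; lia.
rewrite [LHS]/= [RHS]/=; case: ifP => // z0; congr (_ * (_ - _)).
apply: eq_bigr => -[a b] j0; congr (_ * _); apply: IH => /=.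
have : (0 < a + b)%N by case: a b j0 => [|a] [|b].
by move: zn; lia.
Qed.

Lemma inverse_recE n z : z.1 + z.2 < n%:Z -> inverse_rec n z = inverse z.
Proof.
case: (boolP ((0 <= z.1) && (0 <= z.2))) => [z0 zn|]; last first.
  by move=> z0; rewrite /inverse !inverse_rec_out.
pose k := (absz (z.1 + z.2)).+1.
have -> : n = (k + (n - k))%N by rewrite /k; lia.
rewrite {}/k.
elim: (n - _)%N => [|k IH]; first by rewrite addn0.
by rewrite addnS -inverse_rec_stable //; lia.
Qed.

Lemma inverse_out z : ~~ ((0 <= z.1) && (0 <= z.2)) -> inverse z = 0.
Proof. exact: inverse_rec_out. Qed.

Lemma inverseP z : \sum_(j <- T) w j * inverse (z - emb j) = delta z.
Proof.
have [z0|z0] := boolP ((0 <= z.1) && (0 <= z.2)); last first.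
  rewrite big1 ?/delta; first by case: eqP z0 => // ->.
  move=> j _; rewrite inverse_out ?mulr0 //=; move: z0; lia.
rewrite (bigD1_seq 0) ?fset_uniq //= subr0 {1}/inverse /= z0 mulVKr //.
rewrite [X in _ - X](eq_bigr (fun j => w j * inverse (z - emb j))) ?subrK //.
move=> -[a b] j0; rewrite inverse_recE //=.
have : (0 < a + b)%N by case: a b j0 => [|a] [|b].
lia.
Qed.

End Inverse.

(** * Multiples of a polynomial with three invertible corners *)

Lemma ex_seq_maximizer (X : eqType) (s : seq X) (P : pred X) (k : X -> int) :
  has P s ->
  exists x, [/\ x \in s, P x & forall y, y \in s -> P y -> k y <= k x].
Proof.
elim: s => //= a s IH.
have [/IH [x [xs Px xmax]] _ | /hasPn nPs] := boolP (has P s).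
  have [Pak | nPak] := boolP (P a && (k x <= k a)).
    case/andP: Pak => Pa le_xa; exists a; split; rewrite ?inE ?eqxx //.
    move=> y; rewrite inE => /predU1P[-> // | ys Py].
    by apply: le_trans le_xa; apply: xmax.
  exists x; split; rewrite ?inE ?xs ?orbT //.
  move=> y; rewrite inE => /predU1P[-> Pa | ys Py]; last exact: xmax.
  by move: nPak; rewrite Pa /=; lia.
rewrite orbF => Pa; exists a; split; rewrite ?inE ?eqxx //.
by move=> y; rewrite inE => /predU1P[-> // | /nPs /negPf ->].
Qed.

(* [S] is the support of a polynomial A.  For each invertible corner c of P, a
   point z maximal on [S] for a form whose strict maximum on T is at c yields
   the point z + c of the support of P A. *)
Lemma three_corners (S : int * int -> Prop) (N u v C : int) (p q : int) :
  (forall z, S z -> 0 <= z.1 < N /\ 0 <= z.2 < N) -> 0 < p -> 0 < q ->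
  (forall a b : int, 0 < a -> 0 < b -> exists z,
     [/\ S z, u * z.1 + v * z.2 = C &
     forall y, S y -> a * z.1 + b * z.2 <= a * y.1 + b * y.2]) ->
  (forall a b : int, 0 < a -> 0 < b -> exists z,
     [/\ S z, u * (z.1 + p) + v * z.2 = C &
     forall y, S y -> a * y.1 - b * y.2 <= a * z.1 - b * z.2]) ->
  (forall a b : int, 0 < a -> 0 < b -> exists z,
     [/\ S z, u * z.1 + v * (z.2 + q) = C &
     forall y, S y -> b * y.2 - a * y.1 <= b * z.2 - a * z.1]) ->
  u = 0 /\ v = 0.
Proof.
wlog: u v C / 0 < u \/ (u = 0 /\ 0 <= v).
  move=> W SN p0 q0 H0 H1 H2.
  have [|u0] := boolP ((0 < u) || ((u == 0) && (0 <= v))).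
    by move=> ?; apply: (W u v C) => //; lia.
  suff : -u = 0 /\ -v = 0 by lia.
  apply: (W (-u) (-v) (-C)) => //; first by lia.
  - move=> a b a0 b0; have [z [? ? ?]] := H0 a b a0 b0.
    by exists z; split=> //; lia.
  - move=> a b a0 b0; have [z [? ? ?]] := H1 a b a0 b0.
    by exists z; split=> //; lia.
  - move=> a b a0 b0; have [z [? ? ?]] := H2 a b a0 b0.
    by exists z; split=> //; lia.
move=> uv SN p0 q0 H0 H1 H2.
have [z1 [S1 e1 M1]] := H1 1 1 isT isT.
have N0 : 0 < N by have := SN _ S1; lia.
case: uv => [u0 | [u0 v0]].
  exfalso; have [v0 | v0 | v0] := ltrgtP 0 v.
  (* The form [(u, v)] would have minimum [C] on [S], but its value at [z1] is [C - u * p]. *)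
  - have [z0 [S0 e0 M0]] := H0 u v u0 v0; have := M0 _ S1; nia.
  - have nv0 : 0 < - v by lia.
    have [z3 [S3 e3 M3]] := H1 u (-v) u0 nv0.
    have [z2 [S2 e2 M2]] := H2 1 1 isT isT.
    have := M3 _ S2; nia.
  - subst v; have [z0 [S0 e0 M0]] := H0 1 1 isT isT.
    (* The weight [N] outweighs any difference of second coordinates in the box, so [z3] has the
       largest first coordinate in [S]; yet [z0] lies [p] further right. *)
    have [z3 [S3 e3 M3]] := H1 N 1 N0 isT; have := M3 _ S0.
    have := SN _ S0; have := SN _ S3; have : z0.1 = z3.1 + p by nia. nia.
subst u; have [v1 | v1] := eqVneq v 0; first by [].
exfalso; have [z0 [S0 e0 M0]] := H0 1 1 isT isT.
have [z3 [S3 e3 M3]] := H2 1 N isT N0; have := M3 _ S0.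
have ez : z0.2 = z3.2 + q by move: e0; rewrite -e3 !mul0r !add0r => /(mulfI v1).
have := SN _ S0; have := SN _ S3; nia.
Qed.

Section Quotient.
Variables (T : {fset nat * nat}) (R : comUnitRingType) (w : nat * nat -> R).
Hypothesis tileT : is_tile T.
Hypothesis c1_gt0 : (1 <= c1 T)%N.
Hypothesis c2_gt0 : (1 <= c2 T)%N.
Hypothesis w0 : w 0 \is a GRing.unit.
Hypothesis w1 : w (c1 T, 0%N) \is a GRing.unit.
Hypothesis w2 : w (0%N, c2 T) \is a GRing.unit.

Variables (A : int * int -> R) (d : nat * nat).
Hypothesis A_box : forall z, A z != 0 -> exists2 i, (i <= d)%O & z = emb i.

Let Q z := \sum_(j <- T) w j * A (z - emb j).

(** For [z] maximizing [k] on the support of [A], only [w c * A z] survives in [Q (z + emb c)]: any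
    other term evaluates [A] where [k] exceeds its maximum. As [w c] is a unit, zero divisors do no
    harm. *)
Lemma top_corner (k : int * int -> int) (c : nat * nat) :
  {morph k : x y / x + y} -> c \in T -> w c \is a GRing.unit ->
  (forall j, j \in T -> j != c -> k (emb j) < k (emb c)) ->
  (exists z, A z != 0) ->
  exists z, [/\ A z != 0, Q (z + emb c) != 0 &
                forall y, A y != 0 -> k y <= k z].
Proof.
move=> kD Tc wc c_max [z0 Az0].
have inbox z : A z != 0 -> z \in [seq emb i | i <- box d].
  by case/A_box => i le_id ->; apply: map_f; rewrite mem_box.
have [|z [_ Az zmax]] :=
  @ex_seq_maximizer _ [seq emb i | i <- box d] (fun z => A z != 0) k.
  by apply/hasP; exists z0 => //; apply: inbox.
exists z; split=> //; last by move=> y Ay; apply: zmax => //; apply: inbox.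
rewrite /Q (bigD1_seq c) ?fset_uniq //= addrK big_seq_cond big1 ?addr0.
  by apply: contraNneq Az => e0; rewrite -[A z](mulKr wc) e0 mulr0.
move=> j /andP[Tj jc].
suff /eqP -> : A (z + emb c - emb j) == 0 by rewrite mulr0.
apply: contraTT (c_max _ Tj jc) => Ay; rewrite -leNgt.
have := zmax _ (inbox _ Ay) Ay.
have : k (z + emb c - emb j) + k (emb j) = k z + k (emb c).
  by rewrite -!kD subrK.
lia.
Qed.

Lemma multiple_not_on_line (u v C : int) :
  (exists z, A z != 0) ->
  (forall z, Q z != 0 -> u * z.1 + v * z.2 = C) -> u = 0 /\ v = 0.
Proof.
move=> A0 Q_line; have [T0 _] := tileT; have [T1 T2] := corners tileT.
have c1_gt0' : 0 < (c1 T)%:Z by lia.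
have c2_gt0' : 0 < (c2 T)%:Z by lia.
pose N : int := (maxn d.1 d.2).+1.
apply: (@three_corners (fun z => A z != 0) N u v C _ _ _ c1_gt0' c2_gt0').
- move=> z /A_box [i]; rewrite le_pairE => id ->.
  by rewrite /N /=; move: id; lia.
- move=> a b a0 b0.
  have [||z [Az Qz zmax]] :=
    @top_corner (fun z => - (a * z.1 + b * z.2)) 0 _ T0 w0 _ A0.
  + by move=> x y /=; lia.
  + move=> -[x y] _ n0 /=; have : (0 < x + y)%N by case: x y n0 => [|x] [|y].
    nia.
  exists z; split=> //; last by move=> y /zmax; lia.
  by have := Q_line _ Qz; rewrite /= !addr0.
- move=> a b a0 b0.
  have [||z [Az Qz zmax]] :=
    @top_corner (fun z => a * z.1 - b * z.2) _ _ T1 w1 _ A0.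
  + by move=> x y /=; lia.
  + move=> -[x y] /le_c1 /= xc; rewrite -pair_eqE /= => n0; nia.
  exists z; split=> //.
  by have := Q_line _ Qz; rewrite /= !addr0.
move=> a b a0 b0.
have [||z [Az Qz zmax]] :=
  @top_corner (fun z => b * z.2 - a * z.1) _ _ T2 w2 _ A0.
+ by move=> x y /=; lia.
+ move=> -[x y] /le_c2 /= xc; rewrite -pair_eqE /= => n0; nia.
exists z; split=> //.
by have := Q_line _ Qz; rewrite /= !addr0.
Qed.

End Quotient.

(** * Aperiodicity *)

Section Nonperiodic.
Variables (T : {fset nat * nat}) (R : finComUnitRingType) (w : nat * nat -> R).
Hypothesis tileT : is_tile T.
Hypothesis c1_gt0 : (1 <= c1 T)%N.
Hypothesis c2_gt0 : (1 <= c2 T)%N.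
Hypothesis w0 : w 0 \is a GRing.unit.
Hypothesis w1 : w (c1 T, 0%N) \is a GRing.unit.
Hypothesis w2 : w (0%N, c2 T) \is a GRing.unit.
Implicit Types (f g : nat * nat -> R) (d m n : nat * nat).

Definition solution d g := forall i, (i <= d)%O -> residue T w g i = 0.

Lemma solutionB d f g :
  solution d f -> solution d g -> solution d (fun i => f i - g i).
Proof. by move=> sf sg i le_id; rewrite residueB sf // sg // subr0. Qed.

(** The residue at [i] is the coefficient of the product of P and its inverse at [z - emb i], which
    is nonzero only for [z = emb i]. *)
Lemma inverse_solution d z :
  (forall i, (i <= d)%O -> z <> emb i) ->
  solution d (fun i => inverse T w (z - emb i)).
Proof.
move=> z_out i /z_out z_i; rewrite /residue.
under eq_bigr => j _ do rewrite embD [emb j + _]addrC opprD addrA.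
by rewrite inverseP ?(proj1 tileT) // /delta subr_eq0; case: eqP.
Qed.

Definition combine m n (a b : nat) : nat * nat :=
  (m.1 * a + n.1 * b, m.2 * a + n.2 * b)%N.

(** The form [(u, v)] takes the same value at [m] and at [n], so on a combination of the two it
    depends only on the sum of the coefficients. *)
Lemma combine_line m n a b (u := m.2%:Z - n.2%:Z) (v := n.1%:Z - m.1%:Z)
    (C := (a + b).+1%:Z * (n.1%:Z * m.2%:Z - n.2%:Z * m.1%:Z)) :
  u * (emb (combine m n a b + m)).1 + v * (emb (combine m n a b + m)).2 = C /\
  u * (emb (combine m n a b + n)).1 + v * (emb (combine m n a b + n)).2 = C.
Proof.
by rewrite /C /u /v /= -addn1 !(PoszD, PoszM); split; ring.
Qed.

Lemma combineDl m n a b : combine m n a b + m = combine m n a.+1 b.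
Proof. by rewrite /combine !mulnS; congr pair => /=; lia. Qed.

Lemma combineDr m n a b : combine m n a b + n = combine m n a b.+1.
Proof. by rewrite /combine !mulnS; congr pair => /=; lia. Qed.

Lemma combine_inj m n a b a' b' : combine m n a b = combine m n a' b' ->
  (a < a')%N -> (a + b = a' + b')%N -> m = n.
Proof.
case: m n => [m1 m2] [n1 n2] [e1 e2] lt_aa' ab.
have [e ea] : exists e, a' = (a + e.+1)%N by exists (a' - a.+1)%N; lia.
have eb : b = (b' + e.+1)%N by lia.
move: e1 e2; rewrite /= ea eb => e1 e2.
by congr pair; apply/eqP; rewrite -(@eqn_pmul2r e.+1) //; apply/eqP; lia.
Qed.

(** Since [g] vanishes on [T], it can be added to any path without changing the range. *)
Lemma nonperiodic m n : m <> n ->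
  exists (D k : nat * nat) g,
    [/\ solution (Order.join m n + D) g, forall j, j \in T -> g j = 0,
        (k <= D)%O & g (k + m) <> g (k + n)].
Proof.
move=> ne_mn; apply: contrapT => no_g.
(* Each [graph s] below is a subset of [U], so among [M.+1] indices two have the same graph. *)
pose U : finType := ({ffun T -> R} * R)%type.
pose M := #|{set U}|.
pose D := combine m n M M; pose d := Order.join m n + D.
have per g k : solution d g -> (forall j, j \in T -> g j = 0) ->
    (k <= D)%O -> g (k + m) = g (k + n).
  by move=> sg g0 kD; apply: contrapT => ne; apply: no_g; exists D, k, g.
pose k (s : 'I_M.+1) := combine m n s (M - s).
have kD s : (k s <= D)%O.
  by rewrite le_pairE /=; apply/andP; have := ltn_ord s; split; apply: leq_add;
    rewrite leq_mul2l; lia.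
pose restriction g : {ffun T -> R} := [ffun j => g (val j)].
pose graph (s : 'I_M.+1) : {set U} :=
  [set x : U | `[< exists g, [/\ solution d g, x.1 = restriction g &
                            x.2 = g (k s + m) - g (k s + n)] >]].
have [s [s' [lt_ss' eq_graph]]] :
    exists s s' : 'I_M.+1, (s < s')%N /\ graph s = graph s'.
  have /injectivePn[s [s' ne_s eq_s]] : ~~ injectiveb graph.
    by apply/injectiveP => /leq_card; rewrite card_ord ltnn.
  have [lt|gt|eq] := ltngtP s s'; first by exists s, s'.
    by exists s', s.
  by rewrite (val_inj eq) eqxx in ne_s.
(* Equality of graphs yields a solution [h] that agrees with [g] on [T] and has at [k s'] the
   difference that [g] has at [k s]; [per] applied to [g - h] transfers it to [g]. *)
have diff g : solution d g ->
    g (k s + m) - g (k s + n) = g (k s' + m) - g (k s' + n).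
  move=> sg; have : (restriction g, g (k s + m) - g (k s + n)) \in graph s.
    by rewrite inE; apply/asboolP; exists g.
  rewrite eq_graph inE => /asboolP[h [/= sh eq_r ->]].
  have gh0 j : j \in T -> g j - h j = 0.
    move=> Tj; have /ffunP/(_ [` Tj]) := eq_r.
    by rewrite !ffunE /= => ->; rewrite subrr.
  have /eqP := per _ (k s') (solutionB sg sh) gh0 (kD s').
  by rewrite subr_eq => /eqP ->; ring.
(* The coefficient at [z] of [(x^(k s) - x^(k s')) (x^m - x^n) F]. *)
pose quad (F : int * int -> R) z :=
  F (z - emb (k s + m)) - F (z - emb (k s + n)) -
  (F (z - emb (k s' + m)) - F (z - emb (k s' + n))).
pose A := quad (inverse T w).
have A_box z : A z != 0 -> exists2 i, (i <= d)%O & z = emb i.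
  move=> Az; apply: contrapT => z_out; case/negP: Az; apply/eqP.
  rewrite /A /quad (diff (fun i => inverse T w (z - emb i))) ?subrr //.
  by apply: inverse_solution => i le_id ez; apply: z_out; exists i.
have QE z : \sum_(j <- T) w j * A (z - emb j) = quad (delta R) z.
  rewrite /A /quad -!(inverseP (proj1 tileT) w0) -!sumrB.
  by apply: eq_bigr => j _; rewrite -!mulrBr !(addrAC z (- emb j)).
pose u := m.2%:Z - n.2%:Z; pose v := n.1%:Z - m.1%:Z.
pose C := M.+1%:Z * (n.1%:Z * m.2%:Z - n.2%:Z * m.1%:Z).
have on_line (t : 'I_M.+1) :
    u * (emb (k t + m)).1 + v * (emb (k t + m)).2 = C /\
    u * (emb (k t + n)).1 + v * (emb (k t + n)).2 = C.
  have le_tM : (t <= M)%N := ltn_ord t.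
  by have := combine_line m n t (M - t); rewrite subnKC.
have [||u0 v0] :=
  @multiple_not_on_line _ _ _ tileT c1_gt0 c2_gt0 w0 w1 w2 A d A_box u v C.
- apply: contrapT => A0; have {}A0 z : A z = 0.
    by apply/eqP; apply: contrapT => /negP ?; apply: A0; exists z.
  (* The coefficient of [quad (delta R)] at [k s + n] is -1: written with [combine], this point has
     first index [s], while the other three have the larger indices [s.+1], [s'] and [s'.+1]. *)
  have := QE (emb (k s + n)); rewrite big1 => [|j _]; last by rewrite A0 mulr0.
  rewrite /quad /delta !subr_eq0 !(inj_eq emb_inj) eqxx /k.
  rewrite !combineDl !combineDr; have sM := ltn_ord s; have s'M := ltn_ord s'.
  do 3![rewrite (introF eqP) => [|/combine_inj e];
    last by apply: ne_mn; apply: e; lia].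
  by rewrite subrr subr0 sub0r => /eqP; rewrite eq_sym oppr_eq0 oner_eq0.
- move=> z; rewrite QE => Qz; have : [|| z == emb (k s + m), z == emb (k s + n),
      z == emb (k s' + m) | z == emb (k s' + n)].
    apply: contraNT Qz; rewrite /quad /delta !subr_eq0 !negb_or.
    by case/and4P => /negPf -> /negPf -> /negPf -> /negPf ->; rewrite !subrr.
  by have [? ?] := on_line s; have [? ?] := on_line s'; case/or4P => /eqP ->.
apply: ne_mn; move: u0 v0; rewrite /u /v; case: (m) (n) => [m1 m2] [n1 n2] /=.
by move=> ? ?; congr pair; lia.
Qed.

End Nonperiodic.

(** * From functions on N^2 to paths and their segments *)

Section Paths.
Variables (T : {fset nat * nat}) (q : nat) (w : pfun q).

Definition path_of (d : nat * nat) (f : nat * nat -> 'Z_q) : pfun q :=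
  [fmap i : tile_at T d => f (val i)].

Lemma ev_path_of d f i : i \in tile_at T d -> ev (path_of d f) i = f i.
Proof. by move=> Ti; rewrite evE ffunE. Qed.

Lemma mem_tile_atD (d i m : nat * nat) :
  i \in T -> (m <= d)%O -> i + m \in tile_at T d.
Proof.
move=> Ti le_md; apply/mem_tile_at; exists m => //.
by apply/mem_translate; exists i.
Qed.

Lemma path_ofP d f : solution T (ev w) d f -> is_path T 0 w d (path_of d f).
Proof.
move=> sf; split=> // m le_md; split=> //; apply: etrans (sf _ le_md).
rewrite /residue big_seq [RHS]big_seq; apply: eq_bigr => j Tj.
by rewrite /restr ev_shift // ev_path_of // mem_tile_atD.
Qed.

Lemma range_path_of d f v : domf v = T -> (forall j, j \in T -> f j = ev v j) ->
  range T (path_of d f) = v.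
Proof.
move=> dom_v fv; apply/fmapP => i; rewrite /range /restr /shift.
have [Ti | nTi] := boolP (i \in T); last first.
  have nvi : i \notin domf v by rewrite dom_v.
  by rewrite (not_fnd nvi) not_fnd.
have vi : i \in domf v by rewrite dom_v.
rewrite in_fnd /= ffunE /= in_fnd -evE -fv //.
by rewrite ev_path_of ?addr0 // -[i]addr0 mem_tile_atD // le_pairE.
Qed.

(** Both segments have degree [D], and [k] is in their domain because 0 is in [T]; the claim
    compares their values at [k]. *)
Lemma segment_path_of f (d m n k D : nat * nat) : (0 : nat * nat) \in T ->
  d = Order.join m n + D -> (k <= D)%O ->
  segment T (path_of d f) m (sub2 (m + d) (Order.join m n)) =
  segment T (path_of d f) n (sub2 (n + d) (Order.join m n)) ->
  f (k + m) = f (k + n).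
Proof.
move=> T0 -> kD.
have sub2E (a : nat * nat) :
    sub2 (sub2 (a + (Order.join m n + D)) (Order.join m n)) a = D.
  by case: a D {kD} => [a1 a2] [D1 D2]; congr pair => /=; lia.
have Dk : k \in tile_at T D by rewrite -[k]add0r mem_tile_atD.
have join_in (a : nat * nat) : (a <= Order.join m n)%O ->
    k + a \in tile_at T (Order.join m n + D).
  rewrite -[k + a]add0r le_pairE => a_le; apply: mem_tile_atD => //.
  by rewrite le_pairE; move: a_le kD; rewrite le_pairE /=; lia.
move=> /(congr1 (fun l => ev l k)); rewrite /segment !sub2E !ev_shift //.
by rewrite !ev_path_of ?join_in ?leUl ?leUr.
Qed.

End Paths.

Theorem theorem5p2 (T : {fset nat * nat}) (q : nat) (w : pfun q)
  (hdata : @basic_data T q 0 w)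
  (hc1 : (1 <= c1 T)%N) (hc2 : (1 <= c2 T)%N)
  (hw0 : @ev q w (0%N, 0%N) \is a GRing.unit)
  (hw1 : @ev q w (c1 T, 0%N) \is a GRing.unit)
  (hw2 : @ev q w (0%N, c2 T) \is a GRing.unit) :
  @aperiodic T q 0 w.
Proof.
case: hdata => tileT _ _ v [dom_v v0] m n ne_mn.
have [D [k [g [sg g0 kD ne_g]]]] :=
  @nonperiodic T _ (ev w) tileT hc1 hc2 hw0 hw1 hw2 m n ne_mn.
set d := Order.join m n + D in sg.
have res_v : residue T (ev w) (ev v) 0 = 0.
  by rewrite -[RHS]v0; apply: eq_bigr => j _; rewrite addr0.
have [f [fv sf]] := extend_box tileT hw1 hw2 d res_v.
have le_d : (Order.join m n <= d)%O by rewrite le_pairE /=; lia.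
(* Either the extension [f] of [v] already separates [k + m] from [k + n], or [f + g] does, with the
   same range. *)
have [e | ne] := EM (f (k + m) = f (k + n)); last first.
  exists d, (path_of T d f); split=> //; first exact: path_ofP.
    exact: range_path_of.
  by move=> /(segment_path_of (proj1 tileT) (erefl d) kD).
have sfg : solution T (ev w) d (fun i => f i + g i).
  by move=> i le_id; rewrite residueD sf // sg // addr0.
exists d, (path_of T d (fun i => f i + g i)); split=> //; first exact: path_ofP.
  by apply: range_path_of => // j Tj; rewrite g0 // addr0 fv.
by move=> /(segment_path_of (proj1 tileT) (erefl d) kD); rewrite e => /addrI.
Qed.
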